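(* Let $F$ be a finite replacement-invariant subset of $[0,1]$. Then: (i) If $F$ is uncountable, then $F$ is dense in $[0,1]$. In particular, if $F$ has non-zero Hausdorff dimension, then $F$ is dense in $[0,1]$. (ii) For any non-empty open subset $U$ of $[0,1]$ (in the subspace topology of $[0,1]$), $\dim_H(U \cap F) = \dim_H F$, where $\dim_H$ denotes Hausdorff dimension.
   Context: Pierce expansions: define $d_1\colon[0,1]\to\mathbb{N}\cup\{\infty\}$ by $d_1(x)=\lfloor 1/x\rfloor$ for $x\neq 0$ and $d_1(0)=\infty$, and $T\colon[0,1]\to[0,1]$ by $T(x)=1-d_1(x)x$ for $x\ne 0$, $T(0)=0$. Put $d_k(x)=d_1(T^{k-1}(x))$ for $k\in\mathbb{N}$. For a sequence $(\tau_k)_{k\in\mathbb{N}}$ in $\mathbb{N}\cup\{\infty\}$ write $\langle \tau_1,\tau_2,\dots\rangle_P=\sum_{k\in\mathbb{N}}(-1)^{k+1}/(\tau_1\cdots\tau_k)$, with conventions $c\cdot\infty=\infty\cdot\infty=\infty$ and $1/\infty=0$; then $x=\langle d_1(x),d_2(x),\dots\rangle_P$ for all $x\in[0,1]$. A subset $F\subseteq[0,1]$ is called finite replacement-invariant if for every $x\in F$, every $n\in\mathbb{N}$ and every $(\tau_1,\dots,\tau_n)\in(\mathbb{N}\cup\{\infty\})^n$ such that there exists $y\in[0,1]$ with $d_k(y)=\tau_k$ for $k\le n$ and $d_k(y)=d_k(x)$ for $k>n$, this $y=\langle\tau_1,\dots,\tau_n,d_{n+1}(x),d_{n+2}(x),\dots\rangle_P$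 belongs to $F$. *)

(* Defs.v *)
From HB Require Import structures.
From mathcomp Require Import all_boot all_order all_algebra.
From mathcomp Require Import all_classical all_reals all_analysis.

Set Implicit Arguments.
Unset Strict Implicit.
Unset Printing Implicit Defensive.

Import Order.TTheory GRing.Theory Num.Theory numFieldNormedType.Exports.

Local Open Scope classical_set_scope.
Local Open Scope ring_scope.

(* Elements of N \cup {oo}, with [None] for oo.  Digits are positive integers:
   for x in [0, 1] no digit of x is [Some 0]. *)
Definition digit := option nat.

Definition digit_mul (a b : digit) : digit :=
  match a, b with
  | Some m, Some n => Some (m * n)%N
  | _, _ => None
  end.

(* 1/a, with 1/oo = 0 *)
Definition digit_inv (R : realType) (a : digit) : R :=
  if a is Some m then m%:R^-1 else 0.

Definition pierce_d1 (R : realType) (x : R) : digit :=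
  if x == 0 then None else Some (Num.truncn x^-1).

Definition pierce_T (R : realType) (x : R) : R :=
  if x == 0 then 0 else 1 - (Num.truncn x^-1)%:R * x.

(* Digit sequences are indexed from 0: [pierce_digit x k] is d_{k+1}(x). *)
Definition pierce_digit (R : realType) (x : R) (k : nat) : digit :=
  pierce_d1 (iter k (@pierce_T R) x).

(* <tau_1, tau_2, ...>_P with tau_{k+1} = [tau k]; the sign of the term of
   index k is therefore (-1)^k.  The value is meaningful only if the series
   converges, which is the case for the digit sequence of a point of [0, 1]. *)
Definition pierce_value (R : realType) (tau : nat -> digit) : R :=
  limn (series (fun k : nat => (-1) ^+ k *
    digit_inv R (\big[digit_mul/Some 1%N]_(j < k.+1) tau j))).

(* (tau_1, ..., tau_n, d_{n+1}(x), d_{n+2}(x), ...) *)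
Definition replace_digits (R : realType) (n : nat) (tau : n.-tuple digit)
    (x : R) (k : nat) : digit :=
  if (k < n)%N then nth None tau k else pierce_digit x k.

Definition finite_replacement_invariant (R : realType) (F : set R) : Prop :=
  F `<=` `[0, 1] /\
  forall (x : R) (n : nat) (tau : n.-tuple digit), F x -> (0 < n)%N ->
    (exists y : R, `[0, 1]%classic y /\
       forall k : nat, pierce_digit y k = replace_digits tau x k) ->
    F (pierce_value R (replace_digits tau x)).

Local Open Scope ereal_scope.

(* Equal to -oo on the empty set. *)
Definition diam (R : realType) (A : set R) : \bar R :=
  ereal_sup [set `|x - y|%:E | x in A & y in A].

(* |A|^s; the empty set contributes 0 also when s = 0, while |{x}|^0 = 1. *)
Definition diam_pow (R : realType) (s : R) (A : set R) : \bar R :=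
  if A == set0 then 0 else poweR (diam A) s.

Definition hausdorff_pre (R : realType) (s delta : R) (A : set R) : \bar R :=
  ereal_inf [set \sum_(0 <= k <oo) diam_pow s (C k) |
    C in [set C : nat -> set R |
           A `<=` \bigcup_k C k /\ forall k, diam (C k) <= delta%:E]].

(* The limit as delta -> 0+ is a supremum, by monotonicity in delta. *)
Definition hausdorff_measure (R : realType) (s : R) (A : set R) : \bar R :=
  ereal_sup [set hausdorff_pre s delta A | delta in [set delta : R | (0 < delta)%R]].

Definition hausdorff_dim (R : realType) (A : set R) : \bar R :=
  ereal_inf [set s%:E | s in [set s : R | (0 <= s)%R /\ hausdorff_measure s A = 0]].

(* Main.v *)
Require Import Defs.
From HB Require Import structures.
From mathcomp Require Import all_boot all_order all_algebra.
From mathcomp Require Import all_classical all_reals all_analysis.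
From mathcomp Require Import ring lra zify.

Set Implicit Arguments.
Unset Strict Implicit.
Unset Printing Implicit Defensive.

Import Order.TTheory GRing.Theory Num.Theory numFieldNormedType.Exports.

Local Open Scope classical_set_scope.
Local Open Scope ring_scope.

(** Pierce digits are strictly increasing, so d_m(x) - m is nondecreasing along
    the expansion.  It is bounded only if x has finitely many digits or digits
    that are eventually consecutive integers, hence only for countably many x.
    For any other x, an arbitrary initial block of digits, prolonged by
    consecutive integers, fits below d_(m+1)(x) for some m, and may replace the
    first m digits of x; the new point belongs to F and is as close as wished
    to a given point of [0, 1].  With m and the first m digits of x fixed, this
    replacement is affine and injective, so F is, up to a countable set, a
    countable union of affine copies of subsets of F near the given point. *)

(** * One step of the Pierce map, and its iterates *)

(** With [d] the digit of [x], [(d+1) x >= 1] gives [(d+1)(1 - d x) <= (d+1) - d = 1]. The last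
    bound has the form of the hypothesis with [d] for the previous digit [a], so the lemma iterates;
    it starts at [a = 0], that is [x <= 1]. *)
Lemma pierce_step (R : realType) (x : R) (a : nat) :
  0 < x -> x <= a.+1%:R^-1 ->
  [/\ (a < Num.truncn x^-1)%N,
      x = (1 - pierce_T x) / (Num.truncn x^-1)%:R,
      0 <= pierce_T x &
      pierce_T x <= (Num.truncn x^-1).+1%:R^-1].
Proof.
move=> x0 xa; have x1 : 0 <= x^-1 by rewrite invr_ge0 ltW.
have ad : (a < Num.truncn x^-1)%N.
  by rewrite truncn_gt_nat -(invrK a.+1%:R) lef_pV2 ?posrE.
have /andP[dx xd] := truncn_itv x1.
rewrite /pierce_T gt_eqF//; move: ad dx xd; set d := Num.truncn _ => ad dx xd.
have d0 : 0 < d%:R :> R by rewrite ltr0n (leq_ltn_trans _ ad).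
have dx1 : d%:R * x <= 1 by rewrite -ler_pdivlMr// div1r.
have xd1 : 1 <= x * d.+1%:R.
  by rewrite mulrC -ler_pdivrMr// div1r ltW.
split => //.
- by rewrite opprB addrC subrK mulrC mulKf ?lt0r_neq0.
- by rewrite subr_ge0.
- rewrite -[leRHS]mul1r ler_pdivlMr//.
  have -> : d.+1%:R = d%:R + 1 :> R by rewrite natr1.
  move: xd1; rewrite -natr1; nra.
Qed.

Lemma pierce_T_itv (R : realType) (x : R) : 0 <= x <= 1 ->
  0 <= pierce_T x <= 1.
Proof.
move=> /andP[]; rewrite le_eqVlt => /predU1P[<- _|x0 x1].
  by rewrite /pierce_T eqxx lexx ler01.
have [|_ _ -> /le_trans->//] := @pierce_step R x 0 x0; first by rewrite invr1.
by rewrite invf_le1// ler1n.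
Qed.

Lemma iter_pierce_T_itv (R : realType) (x : R) n : 0 <= x <= 1 ->
  0 <= iter n (@pierce_T R) x <= 1.
Proof. by move=> x01; elim: n => //= n; exact: pierce_T_itv. Qed.

Lemma iter_pierce_T_le (R : realType) (x : R) n : 0 <= x <= 1 ->
  iter n (@pierce_T R) x <= n.+1%:R^-1.
Proof.
move=> x01; elim: n => [|n IH /=]; first by rewrite invr1; case/andP: x01.
have /andP[] := iter_pierce_T_itv n x01.
rewrite le_eqVlt => /predU1P[<- _|x0 _].
  by rewrite /pierce_T eqxx invr_ge0.
have [nd _ _ /le_trans->//] := pierce_step x0 IH.
by rewrite lef_pV2 ?posrE// ler_nat.
Qed.

Lemma iter_pierce_T0 (R : realType) n : iter n (@pierce_T R) 0 = 0.
Proof. by elim: n => //= n ->; rewrite /pierce_T eqxx. Qed.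

Lemma pierce_digitE (R : realType) (x : R) k : iter k (@pierce_T R) x != 0 ->
  pierce_digit x k = Some (Num.truncn (iter k (@pierce_T R) x)^-1).
Proof. by rewrite /pierce_digit /pierce_d1 => /negbTE ->. Qed.

Lemma pierce_digit_iter (R : realType) (x : R) m k :
  pierce_digit (iter m (@pierce_T R) x) k = pierce_digit x (k + m).
Proof. by rewrite /pierce_digit iterD. Qed.

Lemma pierce_digit_mono (R : realType) (x : R) k : 0 <= x <= 1 ->
  (forall n, iter n (@pierce_T R) x != 0) ->
  (Num.truncn (iter k (@pierce_T R) x)^-1
    < Num.truncn (iter k.+1 (@pierce_T R) x)^-1)%N.
Proof.
move=> x01 nz.
have gt0 n : 0 < iter n (@pierce_T R) x.
  by rewrite lt_def nz; case/andP: (iter_pierce_T_itv n x01).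
have le1 : iter k (@pierce_T R) x <= 1%:R^-1.
  by rewrite invr1; case/andP: (iter_pierce_T_itv k x01).
have [_ _ _ h] := pierce_step (gt0 k) le1.
by have [] := pierce_step (gt0 k.+1) h.
Qed.

(** * Inverse branches and initial blocks of digits *)

(* The inverse branch of T^n attached to the digits c_1, ..., c_n. *)
Definition pierce_branch (R : realType) (s : seq nat) (t : R) : R :=
  foldr (fun c t => (1 - t) / c%:R) t s.

(** Each digit [c] contributes an affine map of slope [-1/c]. A zero entry is covered too, both
    sides being 0 by the convention [0^-1 = 0]. *)
Lemma pierce_branch_dist (R : realType) s (t u : R) :
  `|pierce_branch s t - pierce_branch s u|
    = (\prod_(c <- s) c)%:R^-1 * `|t - u|.
Proof.
elim: s => [|c s IH] /=; first by rewrite big_nil invr1 mul1r.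
rewrite big_cons natrM invfM -mulrA -IH -mulrBl normrM mulrC normfV normr_nat.
by congr (_ * _); rewrite -normrN; congr `| _ |; ring.
Qed.

Lemma pierce_branch_dist_le (R : realType) s (t u : R) :
  `|pierce_branch s t - pierce_branch s u| <= `|t - u|.
Proof.
rewrite pierce_branch_dist ler_piMl//.
case: (\prod_(c <- s) c)%N => [|n]; first by rewrite invr0 ler01.
by rewrite invf_le1// ler1n.
Qed.

Lemma pierce_branch_cat (R : realType) s1 s2 (t : R) :
  pierce_branch (s1 ++ s2) t = pierce_branch s1 (pierce_branch s2 t).
Proof. exact: foldr_cat. Qed.

Lemma pierce_branch_rcons (R : realType) s c (t : R) :
  pierce_branch (rcons s c) t = pierce_branch s ((1 - t) / c%:R).
Proof. by rewrite -cats1 pierce_branch_cat. Qed.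

Lemma leq_size_last a s : path ltn a s -> (a + size s <= last a s)%N.
Proof.
elim: s a => [|c s IH] a /=; first by rewrite addn0.
by move=> /andP[ac /IH]; apply: leq_trans; rewrite addnS -addSn leq_add2r.
Qed.

(** The block [s] holds the first [n] digits, or all of them if the expansion stops earlier. The
    bound by the last digit is the hypothesis of [pierce_step] for the next one; an empty block
    counts as having last digit 0. *)
Lemma pierce_expansion (R : realType) (x : R) n : 0 <= x <= 1 ->
  exists s, [/\ path ltn 0 s,
    x = pierce_branch s (iter (size s) (@pierce_T R) x),
    iter (size s) (@pierce_T R) x <= (last 0%N s).+1%:R^-1 &
    size s = n \/ iter (size s) (@pierce_T R) x = 0].
Proof.
move=> x01; elim: n => [|n [s [ps xs xl [sn|x0]]]].
- by exists [::]; split => //=; [rewrite invr1; case/andP: x01 | left].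
- have /andP[] := iter_pierce_T_itv (size s) x01.
  rewrite le_eqVlt => /predU1P[x0 _|x0 _].
    by exists s; split => //; right.
  have [ad xE T0 Td] := pierce_step x0 xl.
  exists (rcons s (Num.truncn (iter (size s) (@pierce_T R) x)^-1)).
  rewrite size_rcons pierce_branch_rcons rcons_path last_rcons; split => //=.
  + by rewrite ps.
  + by rewrite -xE.
  + by left; rewrite sn.
- by exists s; split => //; right.
Qed.

(** If [0 < u < 1/(c+1)], then [c/(1-u)], the inverse of [(1-u)/c], lies strictly between [c] and
    [c+1], so the digit read off is [c] and the map returns [u]. Prepending the digits one by one
    gives the whole block. *)
Lemma pierce_branch_digits (R : realType) a s (t : R) :
  path ltn a s -> 0 < t < (last a s).+1%:R^-1 ->
  [/\ 0 < pierce_branch s t < a.+1%:R^-1,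
      iter (size s) (@pierce_T R) (pierce_branch s t) = t &
      forall k, (k < size s)%N ->
        pierce_digit (pierce_branch s t) k = Some (nth 0%N s k)].
Proof.
elim: s a => [|c s IH] a /=; first by [].
move=> /andP[ac ps] tl; have [] := IH _ ps tl.
set u := pierce_branch s t => /andP[u0 uc] us ud.
have c0 : 0 < c%:R :> R by rewrite ltr0n (leq_ltn_trans _ ac).
have c1 : 0 < c.+1%:R :> R by [].
have u1 : u * c.+1%:R < 1 by rewrite -ltr_pdivlMr// mul1r.
have v0 : 0 < (1 - u) / c%:R.
  apply: divr_gt0 => //; rewrite subr_gt0 (lt_le_trans uc)// invf_le1//.
  by rewrite ler1n.
have vE : ((1 - u) / c%:R)^-1 = c%:R / (1 - u) by rewrite invf_div.
have u10 : 0 < 1 - u by move: v0; rewrite pmulr_lgt0 ?invr_gt0.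
have tr : Num.truncn ((1 - u) / c%:R)^-1 = c.
  apply: truncn_def; rewrite vE ler_pdivlMr// ltr_pdivrMr//.
  apply/andP; split; first by rewrite ler_piMr ?ltW//; lra.
  by move: u1; rewrite -natr1; nra.
have Tv : pierce_T ((1 - u) / c%:R) = u.
  by rewrite /pierce_T gt_eqF// tr mulrC divfK ?gt_eqF// opprB addrC subrK.
split.
- rewrite v0/= (@lt_le_trans _ _ c%:R^-1)//.
    by rewrite ltr_pdivrMr// mulVf ?gt_eqF//; lra.
  by rewrite lef_pV2 ?posrE// ler_nat.
- by rewrite -iterS iterSr Tv.
- case=> [_|k]; first by rewrite /pierce_digit/= /pierce_d1 gt_eqF// tr.
  by rewrite ltnS => /ud <-; rewrite /pierce_digit iterSr Tv.
Qed.

(** * Pierce series and replacement of digits *)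

Lemma big_digit_mul (f : nat -> nat) n :
  \big[digit_mul/Some 1%N]_(j < n) Some (f j) = Some (\prod_(j < n) f j)%N.
Proof. by rewrite (big_morph Some (id1 := Some 1%N) (op1 := digit_mul)). Qed.

(** The remainder after [n] terms is, up to sign, [T^n x / (d_1 ... d_n)], hence at most [1/(n+1)]
    in absolute value. *)
Lemma pierce_valueE (R : realType) (x : R) : 0 <= x <= 1 ->
  (forall n, iter n (@pierce_T R) x != 0) ->
  pierce_value R (pierce_digit x) = x.
Proof.
move=> x01 nz; pose d k := Num.truncn (iter k (@pierce_T R) x)^-1.
rewrite /pierce_value; set u := (fun k => _).
have uE k : u k = (-1) ^+ k * (\prod_(j < k.+1) d j)%:R^-1.
  rewrite /u (eq_bigr (fun j : 'I_k.+1 => Some (d j))) ?big_digit_mul//.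
  by move=> j _; exact: pierce_digitE.
have rest n : x - series u n =
    (-1) ^+ n * (\prod_(j < n) d j)%:R^-1 * iter n (@pierce_T R) x.
  elim: n => [|n IH].
    by rewrite /series/= big_geq// big_ord0 invr1 expr0 !mul1r subr0.
  have /andP[T0 T1] := iter_pierce_T_itv n x01.
  have [||_ xE _ _] := @pierce_step R (iter n (@pierce_T R) x) 0.
  - by rewrite lt_def nz.
  - by rewrite invr1.
  rewrite /series/= big_nat_recr//= opprD addrA -/(series u n) IH.
  rewrite [X in _ * X - _]xE uE -/(d n) big_ord_recr natrM invfM exprS; ring.
apply: cvg_lim => //; apply/cvgrPdist_le => e e0.
have := @cvg_harmonic R => /cvgrPdist_le/(_ e e0).
apply: filterS => n; rewrite sub0r normrN => /(le_trans _); apply.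
rewrite rest !normrM normr_sign mul1r /harmonic/=.
rewrite (ger0_norm (_ : 0 <= n.+1%:R^-1))//.
have /andP[T0 _] := iter_pierce_T_itv n x01.
rewrite (ger0_norm T0); apply: le_trans (iter_pierce_T_le n x01).
rewrite ler_piMl// ger0_norm//.
case: (\prod_(j < n) d j)%N => [|m]; first by rewrite invr0 ler01.
by rewrite invf_le1// ler1n.
Qed.

(** Translates invariance from digit sequences to inverse branches. The strict bound makes the
    digits of [s] followed by the tail of [x] a genuine expansion, and the branch point is the [y]
    that the definition of invariance asks for. *)
Lemma branch_mem (R : realType) (F : set R) s (x : R) :
  finite_replacement_invariant F -> F x ->
  (forall n, iter n (@pierce_T R) x != 0) ->
  (0 < size s)%N -> path ltn 0 s ->
  iter (size s) (@pierce_T R) x < (last 0%N s).+1%:R^-1 ->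
  F (pierce_branch s (iter (size s) (@pierce_T R) x)).
Proof.
move=> [F01 Finv] Fx nz s0 ps xl.
have x01 : 0 <= x <= 1 by have := F01 _ Fx; rewrite /= in_itv.
set t := iter _ _ x in xl *; set y := pierce_branch s t.
have t0 : 0 < t.
  by rewrite lt_def nz; case/andP: (iter_pierce_T_itv (size s) x01).
have [|/andP[y0]] := @pierce_branch_digits R 0 s t ps; first by rewrite t0.
rewrite invr1 -/y => y1 yt yd.
pose tau : (size s).-tuple digit := map_tuple (@Some nat) (in_tuple s).
have ydE k : pierce_digit y k = replace_digits tau x k.
  rewrite /replace_digits; case: ltnP => ks.
    by rewrite yd//= (nth_map 0%N).
  by rewrite -(subnK ks) -!pierce_digit_iter yt.
rewrite -(@pierce_valueE R y); last 2 first.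
- by rewrite !ltW.
- move=> n; apply/eqP => yn0; have : pierce_digit y n = None.
    by rewrite /pierce_digit /pierce_d1 yn0 eqxx.
  case: (ltnP n (size s)) => [ns|sn]; first by rewrite yd.
  by rewrite -(subnK sn) -pierce_digit_iter yt pierce_digit_iter pierce_digitE.
rewrite (_ : pierce_digit y = replace_digits tau x); last exact/funext.
apply: Finv => //.
by exists y; split => //=; rewrite in_itv/= !ltW.
Qed.

(** * Eventually consecutive digits, and blocks near a given point *)

(** The sequence [g j - j] is nondecreasing and bounded, hence eventually constant. The induction is
    on the slack [b - g 0]. *)
Lemma affine_of_bounded_slope (g : nat -> nat) b :
  (forall j, (g j < g j.+1)%N) -> (forall j, (g j <= b + j)%N) ->
  exists M, forall k, g (M + k)%N = (g M + k)%N.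
Proof.
move: {2}(b - g 0%N)%N.+1 (ltnSn (b - g 0%N)) => N.
elim: N g b => // N IH g b gN gS gb.
have [g0|/existsNP[k gk]] := pselect (forall k, g k = (g 0%N + k)%N).
  by exists 0%N.
have gle j : (g 0%N + j <= g j)%N.
  elim: j => [|j IHj]; first by rewrite addn0.
  by rewrite addnS (leq_ltn_trans IHj).
(* Restarting at an index [k] where [g k > g 0 + k] strictly decreases the slack. *)
have [||j|M hM] := IH (fun j => g (k + j)%N) (b + k)%N.
- by rewrite addn0; have := gle k; have := gb k; lia.
- by move=> j; rewrite addnS.
- by rewrite -addnA.
- by exists (k + M)%N => j; rewrite -addnA hM.
Qed.

Lemma path_ltn_iota a k : path ltn a (iota a.+1 k).
Proof. by elim: k a => //= k IH a; rewrite ltnSn IH. Qed.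

Lemma last_iota_succ a k : last a (iota a.+1 k) = (a + k)%N.
Proof. by elim: k a => [|k IH] a; rewrite ?addn0//= IH addSnnS. Qed.

Lemma prod_path_ltn_gt0 s : path ltn 0 s -> (0 < \prod_(c <- s) c)%N.
Proof.
move=> /(order_path_min ltn_trans)/allP s0.
by rewrite big_seq; apply: prodn_cond_gt0 => c; exact: s0.
Qed.

(** The block consists of the first [N] digits of [u], where [1/N < e]. If the expansion of [u]
    stops earlier, one large digit is appended to its digits instead. *)
Lemma branch_near (R : realType) (u e : R) : 0 <= u <= 1 -> 0 < e ->
  exists s, [/\ (0 < size s)%N, path ltn 0 s &
    forall t : R, 0 < t < (last 0%N s).+1%:R^-1 ->
      `|u - pierce_branch s t| < e].
Proof.
move=> u01 e0; pose N := (Num.truncn e^-1).+1.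
have small k : (N <= k)%N -> k%:R^-1 < e.
  move=> Nk; have k0 : 0 < k%:R :> R by rewrite ltr0n (leq_trans _ Nk).
  rewrite -(invrK e) ltf_pV2 ?posrE ?invr_gt0// (lt_le_trans (truncnS_gt _))//.
  by rewrite ler_nat.
have [s [ps us ul h]] := pierce_expansion N u01.
have /andP[T0 _] := iter_pierce_T_itv (size s) u01.
have [z|/eqP nz] := eqVneq (iter (size s) (@pierce_T R) u) 0.
  (* The new digit exceeds the last one and is at least [N], so the tail it starts is below [1/N],
     close to the tail 0 of [u]. It also makes the block nonempty when [u = 0]. *)
  exists (rcons s (last 0%N s + N)); rewrite size_rcons rcons_path last_rcons.
  split => //; first by rewrite ps/= -[ltnLHS]addn0 ltn_add2l.
  move=> t /andP[t0 t1]; rewrite {1}us z pierce_branch_rcons.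
  rewrite (le_lt_trans (pierce_branch_dist_le _ _ _))// sub0r normrN.
  have c0 : 0 < (last 0%N s + N)%:R :> R by rewrite ltr0n addn_gt0 orbT.
  have t1' : t < 1.
    by rewrite (lt_le_trans t1)// invf_le1// ler1n.
  rewrite ger0_norm; last by rewrite divr_ge0 ?ltW// subr_gt0.
  apply: lt_trans (small _ (leq_addl (last 0%N s) N)).
  by rewrite ltr_pdivrMr// mulVf ?gt_eqF//; lra.
case: h => // sN; exists s; rewrite sN; split => // t /andP[t0 t1].
rewrite {1}us (le_lt_trans (pierce_branch_dist_le _ _ _))//.
(* The tails [t] and [T^N u] both lie in [[0, 1/(last+1)]], an interval shorter than [e]. *)
have lN : (N <= (last 0%N s).+1)%N.
  by rewrite -sN ltnW// ltnS; exact: (leq_size_last ps).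
move: (small _ lN) ul t1 T0; move: _^-1 (iter _ _ _) => b v be vb tb v0.
by rewrite ltr_norml; apply/andP; split; lra.
Qed.

(** [None] stands for a finite expansion, [Some c] for the tail of digits [c, c+1, c+2, ...].
    Parametrisation by a countable type makes countability of the range immediate. *)
Definition exceptional_point (R : realType) (p : seq nat * option nat) : R :=
  pierce_branch p.1
    (if p.2 is Some c then pierce_value R (fun k => Some (c + k)%N) else 0).

Lemma exceptional_of_slow_digits (R : realType) (x : R) a n0 : 0 <= x <= 1 ->
  (forall m, (n0 <= m)%N ->
    (a + (m - n0)).+1%:R^-1 <= iter m (@pierce_T R) x) ->
  range (exceptional_point R) x.
Proof.
move=> x01 xa.
have nz m : iter m (@pierce_T R) x != 0.
  apply/eqP => x0; have := xa (n0 + m)%N (leq_addr _ _).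
  by rewrite iterD x0 iter_pierce_T0 leNgt invr_gt0 ltr0n.
pose g j := Num.truncn (iter (j + n0) (@pierce_T R) x)^-1.
(* The bound is [a.+1] and not [a]: an iterate equal to [1/(a+j+1)] has digit [a+j+1]. *)
have [j|j|M gM] := @affine_of_bounded_slope g a.+1.
- exact: pierce_digit_mono.
- have := xa (j + n0)%N (leq_addl _ _); rewrite addnK => xj.
  have x0 : 0 < iter (j + n0) (@pierce_T R) x.
    by rewrite (lt_le_trans _ xj)// invr_gt0.
  rewrite /g truncn_le_nat -(invrK _.+1%:R) ltf_pV2 ?posrE ?invr_gt0//.
  by rewrite (lt_le_trans _ xj)// ltf_pV2 ?posrE// ltr_nat.
- have [s [_ xs _ [sM|s0]]] := pierce_expansion (M + n0) x01; last first.
    by have := nz (size s); rewrite s0 eqxx.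
  exists (s, Some (g M)) => //; rewrite /exceptional_point/= [RHS]xs.
  congr pierce_branch.
  rewrite -[RHS]pierce_valueE; last 2 first.
  + exact: iter_pierce_T_itv.
  + by move=> n; rewrite -iterD.
  congr pierce_value; apply/funext => k.
  by rewrite pierce_digit_iter pierce_digitE// sM -gM /g addnCA addnA addnC.
Qed.

(** * Decomposition of an invariant set *)

(** Common source of density and of the dimension formula. On [A i] the old block is an inverse
    branch, which does not increase distances, and the new block contracts by exactly [1 / L i];
    this bounds [f i] from below. *)
Lemma decomposition (R : realType) (F : set R) (u e : R) :
  finite_replacement_invariant F -> 0 <= u <= 1 -> 0 < e ->
  exists (E : set R) (A : nat -> set R) (f : nat -> R -> R) (L : nat -> R),
  [/\ countable E, F `<=` E `|` \bigcup_i A i,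
      forall i x, A i x -> F (f i x) /\ `|u - f i x| < e,
      forall i, 0 < L i &
      forall i x y, A i x -> A i y -> `|x - y| <= L i * `|f i x - f i y|].
Proof.
move=> hF u01 e0; have [s [s0 ps su]] := branch_near u01 e0.
have F01 x : F x -> 0 <= x <= 1 by move=> /hF.1; rewrite /= in_itv.
(* Consecutive integers keep the last digit as small as possible. The subtraction truncates, so
   [tau m] has length [m] only if [size s <= m]. *)
pose tau m := s ++ iota (last 0%N s).+1 (m - size s).
have ptau m : path ltn 0 (tau m) by rewrite cat_path ps path_ltn_iota.
have ltau m : last 0%N (tau m) = (last 0%N s + (m - size s))%N.
  by rewrite last_cat last_iota_succ.
have stau m : (size s <= m)%N -> size (tau m) = m.
  by move=> sm; rewrite size_cat size_iota subnKC.
(* [r] is the block of initial digits of x that [f r] replaces by the block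
   [tau (size r)] of the same length. *)
pose A (r : seq nat) := [set x | [/\ F x, forall n, iter n (@pierce_T R) x != 0,
  (size s <= size r)%N, x = pierce_branch r (iter (size r) (@pierce_T R) x) &
  iter (size r) (@pierce_T R) x < (last 0%N (tau (size r))).+1%:R^-1]].
pose f (r : seq nat) (x : R) :=
  pierce_branch (tau (size r)) (iter (size r) (@pierce_T R) x).
pose L (r : seq nat) := (\prod_(c <- tau (size r)) c)%:R : R.
have L0 r : 0 < L r by rewrite ltr0n prod_path_ltn_gt0.
(* Indices that code no block get [[::]], for which [A] is empty because [s] is nonempty. *)
pose dec i : seq nat := odflt [::] (unpickle i).
exists (range (exceptional_point R)), (A \o dec), (f \o dec), (L \o dec).
split => //=.
- apply: sub_countable (card_image_le _ _) _; exact: countableP.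
- move=> x Fx.
  have [[n x0]|/forallNP nz] := pselect (exists n, iter n (@pierce_T R) x = 0).
    left; have [r [_ xr _ rn]] := pierce_expansion n (F01 _ Fx).
    have r0 : iter (size r) (@pierce_T R) x = 0 by case: rn => // ->.
    by exists (r, None) => //; rewrite /exceptional_point/= [RHS]xr r0.
  have [[m [sm xm]]|/forallNP h] := pselect (exists m, (size s <= m)%N /\
      iter m (@pierce_T R) x < (last 0%N (tau m)).+1%:R^-1).
    right; have [r [_ xr _ [rm|/nz//]]] := pierce_expansion m (F01 _ Fx).
    exists (pickle r) => //=; rewrite /dec pickleK/=.
    split => //; rewrite ?rm//.
    by move=> n; apply/eqP/nz.
  (* If [tau m] fits below the tail of [x] for no [m], the iterates of [x] stay above the inverses
     of consecutive integers. *)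
  left; apply: (@exceptional_of_slow_digits _ x (last 0%N s) (size s)).
    exact: F01.
  move=> m sm; rewrite leNgt; apply/negP => xm; apply: (h m); split => //.
  by rewrite ltau.
- move=> i x; move: (dec i) => r [Fx nz sr xr xt].
  have t0 : 0 < iter (size r) (@pierce_T R) x.
    by rewrite lt_def nz; have /andP[] := iter_pierce_T_itv (size r) (F01 _ Fx).
  split.
    rewrite /f -{2}(stau _ sr); apply: branch_mem => //; rewrite stau//.
    exact: leq_trans sr.
  (* The consecutive part of [tau] only moves the tail to another point of the interval on which [s]
     gives points near [u]. *)
  rewrite /f pierce_branch_cat; apply: su.
  have [||+ _ _ //] := @pierce_branch_digits R (last 0%N s)
    (iota (last 0%N s).+1 (size r - size s)) (iter (size r) (@pierce_T R) x).
    exact: path_ltn_iota.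
  by rewrite t0; move: xt; rewrite last_cat.
- move=> i x y; move: (dec i) => r [_ _ _ xr _] [_ _ _ yr _].
  rewrite /f pierce_branch_dist mulrA mulfV ?gt_eqF// mul1r {1}xr {1}yr.
  exact: pierce_branch_dist_le.
Qed.

(** * Null sets of Hausdorff measures *)

Lemma dist_le_diam (R : realType) (A : set R) (x y : R) :
  A x -> A y -> (`|x - y|%:E <= diam A)%E.
Proof. by move=> Ax Ay; apply: ereal_sup_ubound; exists x => //; exists y. Qed.

Lemma diam_ge0 (R : realType) (A : set R) : A !=set0 -> (0 <= diam A)%E.
Proof. by move=> [x Ax]; rewrite (le_trans _ (dist_le_diam Ax Ax)). Qed.

Lemma diam_pow_ge0 (R : realType) (s : R) (A : set R) : (0 <= diam_pow s A)%E.
Proof. by rewrite /diam_pow; case: ifP => // _; exact: poweR_ge0. Qed.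

(** Reduces nullity to the existence of cheap fine covers, the form used in all the closure
    properties below. *)
Lemma hausdorff_measure0P (R : realType) (s : R) (A : set R) :
  hausdorff_measure s A = 0%E <->
  forall delta e : R, 0 < delta -> 0 < e -> exists C : nat -> set R,
    [/\ A `<=` \bigcup_k C k, forall k, (diam (C k) <= delta%:E)%E &
        (\sum_(0 <= k <oo) diam_pow s (C k) <= e%:E)%E].
Proof.
split=> [H0 delta e d0 e0|H].
  have : (hausdorff_pre s delta A < e%:E)%E.
    rewrite (@le_lt_trans _ _ 0%E) ?lte_fin// -H0.
    by apply: ereal_sup_ubound; exists delta.
  move=> /ereal_inf_lt[_ [C [AC Cd] <-] Ce].
  by exists C; split => //; exact: ltW.
have pre0 delta : 0 < delta -> hausdorff_pre s delta A = 0%E.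
  move=> d0; apply/eqP; rewrite eq_le; apply/andP; split.
    apply/lee_addgt0Pr => e e0; rewrite add0e.
    have [C [AC Cd Ce]] := H _ _ d0 e0.
    by apply: le_trans Ce; apply: ereal_inf_lbound; exists C.
  apply: le_ereal_inf_tmp => _ [C _ <-].
  by apply: nneseries_ge0 => k _ _; exact: diam_pow_ge0.
apply/eqP; rewrite eq_le; apply/andP; split.
  by apply: ge_ereal_sup => _ [delta d0 <-]; rewrite pre0.
by apply: ereal_sup_ubound; exists 1 => //=; exact: pre0.
Qed.

Lemma hausdorff_measure0S (R : realType) (s : R) (A B : set R) : A `<=` B ->
  hausdorff_measure s B = 0%E -> hausdorff_measure s A = 0%E.
Proof.
move=> AB /hausdorff_measure0P H; apply/hausdorff_measure0P => delta e d0 e0.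
have [C [BC ? ?]] := H _ _ d0 e0.
by exists C; split => //; exact: subset_trans BC.
Qed.

(** Covers of [A i] of cost at most [e / 2^(i+1)] are merged into one sequence along a bijection
    from [nat] to [nat * nat]. *)
Lemma hausdorff_measure0_bigcup (R : realType) (s : R) (A : nat -> set R) :
  (forall i, hausdorff_measure s (A i) = 0%E) ->
  hausdorff_measure s (\bigcup_i A i) = 0%E.
Proof.
move=> H; apply/hausdorff_measure0P => delta e d0 e0.
have /choice[C HC] : forall i, exists C : nat -> set R,
    [/\ A i `<=` \bigcup_k C k, forall k, (diam (C k) <= delta%:E)%E &
        (\sum_(0 <= k <oo) diam_pow s (C k) <= (e / (2 ^ i.+1)%:R)%:E)%E].
  move=> i; have /hausdorff_measure0P/(_ delta) := H i; apply => //.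
  by rewrite divr_gt0// ltr0n expn_gt0.
have /card_esym/ppcard_eqP[f] := card_nat2.
exists (fun n => C (f n).1 (f n).2); split.
- move=> x [i _ Aix]; have [/(_ _ Aix)[k _ Cx] _ _] := HC i.
  by exists (f^-1%FUN (i, k)) => //=; rewrite invK ?inE.
- by move=> n; have [] := HC (f n).1.
- rewrite nneseries_esumT; last by move=> n; exact: diam_pow_ge0.
  rewrite -(reindex_esum setT setT f
    (fun p => diam_pow s (C p.1 p.2))); last first.
    exact: 'bij_f.
  rewrite (_ : [set: nat * nat] = setT `*`` (fun=> setT)); last first.
    by apply/seteqP; split.
  rewrite -(esum_esum (a := fun i k => diam_pow s (C i k))); last first.
    by move=> *; exact: diam_pow_ge0.
  rewrite -nneseries_esumT; last first.
    by move=> n; apply: esum_ge0 => *; exact: diam_pow_ge0.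
  apply: le_trans (epsilon_trick0 xpredT (ltW e0)).
  apply: lee_nneseries => i _ => [_|].
    by apply: esum_ge0 => *; exact: diam_pow_ge0.
  rewrite -nneseries_esumT; first by have [] := HC i.
  by move=> *; exact: diam_pow_ge0.
Qed.

(** The cover is by sets of at most one point, each of cost [0^s = 0] since [s] is nonzero. *)
Lemma hausdorff_measure0_countable (R : realType) (s : R) (A : set R) :
  s != 0 -> countable A -> hausdorff_measure s A = 0%E.
Proof.
move=> s0 /countable_injP[f finj]; apply/hausdorff_measure0P => delta e d0 e0.
pose C k := A `&` f @^-1` [set k].
have C1 k x y : C k x -> C k y -> x = y.
  move=> [Ax fx] [Ay fy]; apply: finj; rewrite ?inE//.
  by move: fx fy => /= -> ->.
have dC k : (diam (C k) <= 0)%E.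
  apply: ge_ereal_sup => _ [x Cx [y Cy <-]].
  by rewrite (C1 _ _ _ Cx Cy) subrr normr0.
exists C; split.
- by move=> x Ax; exists (f x).
- by move=> k; rewrite (le_trans (dC k))// lee_fin ltW.
- rewrite eseries0 ?lee_fin ?ltW// => k _ _; rewrite /diam_pow.
  case: ifPn => // /set0P Ck; rewrite (_ : diam (C k) = 0%E) ?poweR0r//.
  by apply/eqP; rewrite eq_le dC diam_ge0.
Qed.

(** A cover of [B] pulled back along [f] has diameters multiplied by at most [L] and cost by at most
    [L^s]; hence the choices [delta / L] and [e / L^s]. *)
Lemma hausdorff_measure0_inv_lipschitz (R : realType) (s L : R) (f : R -> R)
    (A B : set R) : 0 <= s -> 0 < L -> (forall x, A x -> B (f x)) ->
  (forall x y, A x -> A y -> `|x - y| <= L * `|f x - f y|) ->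
  hausdorff_measure s B = 0%E -> hausdorff_measure s A = 0%E.
Proof.
move=> s0 L0 AB fL /hausdorff_measure0P HB.
apply/hausdorff_measure0P => delta e d0 e0.
have Ls0 : 0 < L `^ s by rewrite powR_gt0.
have [C [BC Cd Ce]] := HB _ _ (divr_gt0 d0 L0) (divr_gt0 e0 Ls0).
pose D k := A `&` f @^-1` (C k).
have dD k : (diam (D k) <= L%:E * diam (C k))%E.
  apply: ge_ereal_sup => _ [x [Ax Cx] [y [Ay Cy] <-]].
  rewrite (@le_trans _ _ (L%:E * `|f x - f y|%:E)%E)//.
    by rewrite -EFinM lee_fin fL.
  by apply: lee_wpmul2l; [rewrite lee_fin ltW|exact: dist_le_diam].
exists D; split.
- by move=> x Ax; have [k _ Ck] := BC _ (AB _ Ax); exists k.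
- move=> k; rewrite (le_trans (dD k))//.
  rewrite (@le_trans _ _ (L%:E * (delta / L)%:E)%E)//.
    by rewrite lee_wpmul2l// lee_fin ltW.
  by rewrite -EFinM mulrC divfK ?gt_eqF.
- apply: (@le_trans _ _ (\sum_(0 <= k <oo) (L `^ s)%:E * diam_pow s (C k))%E).
    apply: lee_nneseries => [k _ _|k _]; first exact: diam_pow_ge0.
    (* An empty trace costs 0 by definition, its diameter being [-oo]; otherwise both diameters are
       nonnegative and the power is monotone. *)
    rewrite {1}/diam_pow; case: ifPn => [_|/set0P Dk].
      by rewrite mule_ge0 ?diam_pow_ge0// lee_fin ltW.
    have Ck : C k !=set0 by case: Dk => x [_ Cx]; exists (f x).
    rewrite /diam_pow ifF; last exact/negbTE/set0P.
    rewrite -poweR_EFin -poweRM ?diam_ge0 ?lee_fin ?(ltW L0)//.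
    have ge0_itv (z : \bar R) : (0 <= z)%E -> z \in `[0%E, +oo%E].
      by move=> z0; rewrite in_itv/= z0 leey.
    apply: gt0_ler_poweR => //; apply: ge0_itv; first exact: diam_ge0.
    by rewrite mule_ge0 ?diam_ge0// lee_fin ltW.
  rewrite nneseriesZl; last by move=> k _; exact: diam_pow_ge0.
  rewrite (@le_trans _ _ ((L `^ s)%:E * (e / L `^ s)%:E)%E)//.
    by rewrite lee_wpmul2l// lee_fin ltW.
  by rewrite -EFinM mulrC divfK ?gt_eqF.
Qed.

(** For exponent 0 every nonempty set of a cover costs 1, so a cover of cost at most 1/2 has only
    empty members. *)
Lemma hausdorff_measure0_eq0 (R : realType) (A : set R) :
  hausdorff_measure 0 A = 0%E -> A = set0.
Proof.
move=> /hausdorff_measure0P/(_ 1 2^-1 ltr01)[|C [AC _ Ce]].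
  by rewrite invr_gt0.
rewrite -subset0 => x /AC[k _ Ckx].
suff : (1 <= (2^-1 : R)%:E)%E by rewrite lee_fin leNgt invf_lt1 ?ltr1n.
apply: le_trans Ce.
rewrite nneseries_esumT; last by move=> n; exact: diam_pow_ge0.
apply: esum_ge; exists [set k]; first by split.
rewrite fsbig_set1 /diam_pow ifF ?poweRe0//.
by apply/negbTE/set0P; exists x.
Qed.

(** * Hausdorff dimension *)

Lemma hausdorff_dim_le (R : realType) (A B : set R) :
  (forall s : R, 0 <= s -> hausdorff_measure s B = 0%E ->
    (hausdorff_dim A <= s%:E)%E) ->
  (hausdorff_dim A <= hausdorff_dim B)%E.
Proof. by move=> H; apply: le_ereal_inf_tmp => _ [s [s0 Bs] <-]; exact: H. Qed.

Lemma hausdorff_dim_le_of_null (R : realType) (A : set R) (s : R) :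
  0 <= s -> hausdorff_measure s A = 0%E -> (hausdorff_dim A <= s%:E)%E.
Proof. by move=> s0 As; apply: ereal_inf_lbound; exists s. Qed.

Lemma hausdorff_dim_ge0 (R : realType) (A : set R) : (0 <= hausdorff_dim A)%E.
Proof. by apply: le_ereal_inf_tmp => _ [s [s0 _] <-]; rewrite lee_fin. Qed.

Lemma hausdorff_dim_countable (R : realType) (A : set R) :
  countable A -> hausdorff_dim A = 0%E.
Proof.
move=> cA; apply/eqP; rewrite eq_le hausdorff_dim_ge0 andbT.
apply/lee_addgt0Pr => e e0; rewrite add0e hausdorff_dim_le_of_null ?ltW//.
by apply: hausdorff_measure0_countable => //; rewrite gt_eqF.
Qed.

(** * Invariant sets near a given point *)

(** A point of some [A i] would be sent by [f i] into the empty trace on the ball, so [F] lies in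
    the countable set [E]. *)
Lemma countable_of_gap (R : realType) (F : set R) (u e : R) :
  finite_replacement_invariant F -> 0 <= u <= 1 -> 0 < e ->
  F `&` ball u e = set0 -> countable F.
Proof.
move=> hF u01 e0 F0.
have [E [A [f [L [cE FEA Af _ _]]]]] := decomposition hF u01 e0.
apply: sub_countable cE; apply: subset_card_le => x /FEA[//|[i _ /Af[Ff uf]]].
by have : (F `&` ball u e) (f i x) by []; rewrite F0.
Qed.

Lemma hausdorff_dim_ball (R : realType) (F : set R) (u e : R) :
  finite_replacement_invariant F -> 0 <= u <= 1 -> 0 < e ->
  (hausdorff_dim F <= hausdorff_dim (F `&` ball u e))%E.
Proof.
move=> hF u01 e0; apply: hausdorff_dim_le => s s0 Bs.
(* At exponent 0 countable sets need not be null, so [E] cannot be discarded; but there a null trace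
   is empty, which makes [F] countable. *)
have [s_eq0|sn0] := eqVneq s 0.
  move: Bs; rewrite s_eq0 => /hausdorff_measure0_eq0.
  move=> /(countable_of_gap hF u01 e0).
  by move=> /hausdorff_dim_countable ->.
have [E [A [f [L [cE FEA Af L0 fL]]]]] := decomposition hF u01 e0.
apply: hausdorff_dim_le_of_null => //.
apply: (hausdorff_measure0S (B := \bigcup_i (if i is j.+1 then A j else E))).
  move=> x /FEA[Ex|[i _ Aix]]; first by exists 0%N.
  by exists i.+1.
apply: hausdorff_measure0_bigcup => -[|i].
  exact: hausdorff_measure0_countable.
by apply: (hausdorff_measure0_inv_lipschitz s0 (L0 i) _ (fL i) Bs) => x /Af.
Qed.

Unset Implicit Arguments.

Theorem theorem1p1 (R : realType) (F : set R)
    (hF : finite_replacement_invariant F) :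
  ((~ countable F -> `[0, 1] `<=` closure F) /\
   (hausdorff_dim F <> 0%E -> `[0, 1] `<=` closure F)) /\
  (forall U : set (subspace (`[0, 1]%classic : set R)),
     U `<=` `[0, 1] -> U !=set0 -> open U ->
     hausdorff_dim (U `&` F) = hausdorff_dim F).
Proof.
have dense : ~ countable F -> `[0, 1] `<=` closure F.
  move=> ncF u; rewrite /= in_itv/= => u01 V /nbhs_ballP[e /= e0 uV].
  have [F0|/set0P] := eqVneq (F `&` ball u e) set0.
    by have := countable_of_gap hF u01 e0 F0.
  by move=> [y [Fy uy]]; exists y; split => //; exact: uV.
split.
  split; first exact: dense.
  move=> dF; apply: dense => cF; apply: dF.
  exact: hausdorff_dim_countable.
move=> U U01 U0 oU.
(* The point is retyped as a real number, so that balls around it are taken in [R] and not in the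
   subspace. *)
have [u Uu] : exists u : R, U u by case: U0 => u Uu; exists u.
have u01 : 0 <= u <= 1 by have := U01 _ Uu; rewrite /= in_itv.
have nU : nbhs (u : subspace `[0, 1]%classic) U by exact: open_nbhs_nbhs.
have [V nV VU] := (@nbhs_subspace_ex R _ U u (U01 _ Uu)).1 nU.
have /nbhs_ballP[e /= e0 eV] := nV.
apply/eqP; rewrite eq_le; apply/andP; split.
  apply: hausdorff_dim_le => s s0 Fs; apply: hausdorff_dim_le_of_null => //.
  by apply: hausdorff_measure0S Fs => x [].
apply: (@le_trans _ _ (hausdorff_dim (F `&` ball u e))).
  exact: hausdorff_dim_ball.
apply: hausdorff_dim_le => s s0 Fs; apply: hausdorff_dim_le_of_null => //.
apply: hausdorff_measure0S Fs => x [Fx /eV Vx]; split => //.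
(* [V] agrees with [U] only inside [[0, 1]], which contains [F]. *)
have : (V `&` `[0, 1]) x by split => //; exact: hF.1.
by rewrite -VU => -[].
Qed.
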